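(* Let $\mathcal{O}\subset\mathfrak{sl}_n(\mathbb{C})$ be a conjugacy class with simple spectrum, $\Lambda\in\mathcal{O}$ diagonal, $\mathcal{U}$ as in the context, and let $X\in\mathcal{U}$ be written as $X=(\Lambda+Y)^{k^{-1}}=(\Lambda+Z)^{u}$ with $Y,Z\in\mathfrak{l}$, $k\in\mathcal{C}$, $u\in\mathcal{D}$. Then the trajectory $X(t)$ of the Toda vector field starting at $X$ admits, for all $t\in\mathbb{R}$, the factorizations $$X(t)=\Big((\Lambda+Y)^{\exp(-t\,i\,\mathrm{Im}\Lambda)}\Big)^{\kappa(l_{\mathrm{Im}}(t))^{-1}},\quad l_{\mathrm{Im}}(t)\in\mathrm{L},$$ $$X(t)=\Big((\Lambda+Z)^{\exp(t\,\mathrm{Re}\Lambda)}\Big)^{\nu(l_{\mathrm{Re}}(t))},\quad l_{\mathrm{Re}}(t)\in\mathrm{L},$$ where $\mathrm{Re}\Lambda$ and $\mathrm{Im}\Lambda$ are the real and imaginary parts of $\Lambda$. In particular, the entire Toda trajectory is contained in $\mathcal{U}$.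
   Context: Work in $\mathrm{SL}_n(\mathbb{C})$ and $\mathfrak{sl}_n(\mathbb{C})$. The Toda vector field is $X'=[X,\pi_{\mathfrak{k}}X]$, where $\mathfrak{sl}_n(\mathbb{C})=\mathfrak{k}\oplus\mathfrak{u}$ with $\mathfrak{k}$ the traceless skew-Hermitian matrices and $\mathfrak{u}$ the traceless upper triangular matrices with real diagonal, and $\pi_{\mathfrak{k}}$ is projection onto $\mathfrak{k}$ along $\mathfrak{u}$. Let $\mathrm{K}=\mathrm{SU}(n)$, $\mathrm{U}$ the upper triangular determinant one matrices with positive diagonal, $\mathrm{L}$ the lower unipotent triangular matrices, $\mathfrak{l}$ the strictly lower triangular matrices; each $g$ factors uniquely $g=\kappa(g)\nu(g)$ with $\kappa(g)\in\mathrm{K}$, $\nu(g)\in\mathrm{U}$. $\mathcal{C}=\kappa(\mathrm{L})$, $\mathcal{D}=\nu(\mathrm{L})$, $X^g=gXg^{-1}$, and $\mathcal{U}=\{\Lambda^{(lk)^{-1}}:k\in\mathcal{C},l\in\mathrm{L}\}$ (an open dense subset of $\mathcal{O}$; every $X\in\mathcal{U}$ can be written uniquely in both forms of the statement). *)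

(* Defs.v *)
From HB Require Import structures.
From mathcomp Require Import all_boot all_algebra.
From mathcomp Require Import complex.
From mathcomp Require Import reals topology normedtype sequences exp trigo derive.

Set Implicit Arguments.
Unset Strict Implicit.
Unset Printing Implicit Defensive.

Import GRing.Theory Num.Theory numFieldNormedType.Exports.
Local Open Scope ring_scope.
Local Open Scope complex_scope.

Section TodaDefs.
Variable R : realType.
Local Notation C := R[i].
Variable n : nat.
Local Notation M := 'M[C]_n.

Definition ctrans (A : M) : M := (map_mx (@conjc R) A)^T.

Definition conjm (g X : M) : M := g *m X *m invmx g.

Definition inK (g : M) : Prop := g *m ctrans g = 1%:M /\ \det g = 1.

Definition inU (g : M) : Prop :=
  (forall i j : 'I_n, (j < i)%N -> g i j = 0) /\
  (forall i : 'I_n, complex.Im (g i i) = 0 /\ 0 < complex.Re (g i i)) /\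
  \det g = 1.

Definition inL (g : M) : Prop :=
  (forall i j : 'I_n, (i < j)%N -> g i j = 0) /\ (forall i : 'I_n, g i i = 1).

Definition in_lalg (Y : M) : Prop := forall i j : 'I_n, (i <= j)%N -> Y i j = 0.

Definition in_kalg (A : M) : Prop := ctrans A = - A /\ \tr A = 0.

Definition in_ualg (A : M) : Prop :=
  (forall i j : 'I_n, (j < i)%N -> A i j = 0) /\
  (forall i : 'I_n, complex.Im (A i i) = 0) /\ \tr A = 0.

(* g = k u with k in K, u in U  (i.e. k = kappa g, u = nu g) *)
Definition is_KU (g k u : M) : Prop := inK k /\ inU u /\ g = k *m u.

Definition in_calC (k : M) : Prop := exists l u, inL l /\ is_KU l k u.
Definition in_calD (u : M) : Prop := exists l k, inL l /\ is_KU l k u.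

Definition in_calU (Lam X : M) : Prop :=
  exists k l, in_calC k /\ inL l /\ X = conjm (invmx (l *m k)) Lam.

(* pi_k X = A : the k-component of X in sl_n = k (+) u *)
Definition proj_k (X A : M) : Prop := in_kalg A /\ in_ualg (X - A).

Definition has_mderiv (F : R -> M) (t : R) (D : M) : Prop :=
  forall i j : 'I_n,
    is_derive t (1 : R) (fun s => complex.Re (F s i j)) (complex.Re (D i j)) /\
    is_derive t (1 : R) (fun s => complex.Im (F s i j)) (complex.Im (D i j)).

Definition toda_solution (F : R -> M) : Prop :=
  forall t : R, exists A, proj_k (F t) A /\
    has_mderiv F t (F t *m A - A *m F t).

Definition mexp (A : M) : M :=
  \matrix_(i, j)
    ((limn (fun N : nat => complex.Re ((\sum_(k < N) (k`!%:R)^-1 *: A ^+ k) i j)))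
       +i* (limn (fun N : nat => complex.Im ((\sum_(k < N) (k`!%:R)^-1 *: A ^+ k) i j)))).

Definition mxRe (A : M) : M := map_mx (fun z : C => (complex.Re z)%:C) A.
Definition mxIm (A : M) : M := map_mx (fun z : C => (complex.Im z)%:C) A.

End TodaDefs.

(* Main.v *)
Require Import Defs.
From HB Require Import structures.
From mathcomp Require Import all_boot all_order all_algebra.
From mathcomp Require Import complex ring lra.
From mathcomp Require Import boolp reals topology normedtype sequences exp trigo.
From mathcomp Require Import derive realfun.

Import Order.TTheory GRing.Theory Num.Theory numFieldNormedType.Exports.
Local Open Scope ring_scope.
Local Open Scope complex_scope.

(* The flow of X is X(t) = V X V^-1 = Q^-1 X Q, where exp(tX) = Q V with Q unitary
   and V upper triangular with positive diagonal.  A smooth QR factorization comes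
   from the recursive Cholesky factorization of exp(tX)^* exp(tX), and uniqueness of
   solutions from a Gronwall estimate for the Frobenius norm of the difference.

   Since the spectrum is simple, Lam + Y = m Lam m^-1 with m lower unipotent, so only
   exponentials of diagonal matrices occur: exp(t Lam) = e^{i t Im Lam} e^{t Re Lam},
   whose first factor is unitary and whose second is in the upper positive group.
   Conjugation by diagonal matrices preserves the lower unipotent group, so these two
   factors can be moved to the left and to the right of a lower unipotent matrix; the
   uniqueness of the QR factorization then gives both formulas. *)

Local Notation Re := complex.Re.
Local Notation Im := complex.Im.

Set Implicit Arguments.
Unset Strict Implicit.
Unset Printing Implicit Defensive.

(** * Derivatives of complex and matrix curves; conjugate transposes *)

Section Calculus.
Variable R : realType.
Local Notation C := R[i].

Lemma cReD (x y : C) : Re (x + y) = Re x + Re y.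
Proof. by case: x; case: y. Qed.

Lemma cImD (x y : C) : Im (x + y) = Im x + Im y.
Proof. by case: x; case: y. Qed.

Lemma cReN (x : C) : Re (- x) = - Re x.
Proof. by case: x. Qed.

Lemma cImN (x : C) : Im (- x) = - Im x.
Proof. by case: x. Qed.

Lemma cReM (x y : C) : Re (x * y) = Re x * Re y - Im x * Im y.
Proof. by case: x; case: y. Qed.

Lemma cImM (x y : C) : Im (x * y) = Re x * Im y + Im x * Re y.
Proof. by case: x; case: y => a b c d /=; rewrite [_ * a]mulrC. Qed.

Lemma cReJ (x : C) : Re (conjc x) = Re x.
Proof. by case: x. Qed.

Lemma cImJ (x : C) : Im (conjc x) = - Im x.
Proof. by case: x. Qed.

Lemma Re_sum (I : Type) (r : seq I) (P : pred I) (F : I -> C) :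
  Re (\sum_(i <- r | P i) F i) = \sum_(i <- r | P i) Re (F i).
Proof. exact: (big_morph _ cReD). Qed.

Lemma Im_sum (I : Type) (r : seq I) (P : pred I) (F : I -> C) :
  Im (\sum_(i <- r | P i) F i) = \sum_(i <- r | P i) Im (F i).
Proof. exact: (big_morph _ cImD). Qed.

Lemma complex_eq (x y : C) : Re x = Re y -> Im x = Im y -> x = y.
Proof. by case: x => a b; case: y => c d /= -> ->. Qed.

Lemma gt0_real_complex (x : C) : 0 < x -> x = (Re x)%:C /\ 0 < Re x.
Proof. by rewrite ltcE /= => /andP[/eqP xi ?]; split => //; apply: complex_eq. Qed.

Lemma conjc_gt0 (x : C) : 0 < x -> conjc x = x.
Proof. by case/gt0_real_complex => -> _; rewrite conjc_real. Qed.

Definition cderiv (f : R -> C) (t : R) (d : C) : Prop :=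
  is_derive t (1 : R) (fun s => Re (f s)) (Re d) /\
  is_derive t (1 : R) (fun s => Im (f s)) (Im d).

Lemma is_derive_ext (f g : R -> R) (t a b : R) :
  f =1 g -> a = b -> is_derive t (1 : R) f a -> is_derive t (1 : R) g b.
Proof. by move=> /funext -> ->. Qed.

Lemma cderiv_ext (f g : R -> C) t a b :
  f =1 g -> a = b -> cderiv f t a -> cderiv g t b.
Proof. by move=> /funext -> ->. Qed.

Lemma cderiv_cst (c : C) t : cderiv (fun _ => c) t 0.
Proof. by split; apply: is_derive_cst. Qed.

Lemma cderivD f g t a b :
  cderiv f t a -> cderiv g t b -> cderiv (fun s => f s + g s) t (a + b).
Proof.
move=> [f1 f2] [g1 g2]; split.
- by apply: is_derive_ext (is_deriveD f1 g1) => [s|]; rewrite cReD.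
- by apply: is_derive_ext (is_deriveD f2 g2) => [s|]; rewrite cImD.
Qed.

Lemma cderivN f t a : cderiv f t a -> cderiv (fun s => - f s) t (- a).
Proof.
move=> [f1 f2]; split.
- by apply: is_derive_ext (is_deriveN f1) => [s|]; rewrite cReN.
- by apply: is_derive_ext (is_deriveN f2) => [s|]; rewrite cImN.
Qed.

Lemma cderivM f g t a b : cderiv f t a -> cderiv g t b ->
  cderiv (fun s => f s * g s) t (a * g t + f t * b).
Proof.
move=> [f1 f2] [g1 g2]; split.
- apply: is_derive_ext (is_deriveB (is_deriveM f1 g1) (is_deriveM f2 g2)) => [s|].
    by rewrite cReM.
  by rewrite cReD !cReM /GRing.scale /=; ring.
- apply: is_derive_ext (is_deriveD (is_deriveM f1 g2) (is_deriveM f2 g1)) => [s|].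
    by rewrite cImM.
  by rewrite cImD !cImM /GRing.scale /=; ring.
Qed.

Lemma cderiv_conj f t a : cderiv f t a -> cderiv (fun s => conjc (f s)) t (conjc a).
Proof.
move=> [f1 f2]; split.
- by apply: is_derive_ext f1 => [s|]; rewrite cReJ.
- by apply: is_derive_ext (is_deriveN f2) => [s|]; rewrite cImJ.
Qed.

Lemma cderiv_real (f : R -> R) t (a : R) :
  is_derive t (1 : R) f a -> cderiv (fun s => (f s)%:C) t a%:C.
Proof. by move=> df; split => //=; apply: is_derive_cst. Qed.

Lemma cderiv_sum n (F : 'I_n -> R -> C) t (D : 'I_n -> C) :
  (forall i, cderiv (F i) t (D i)) ->
  cderiv (fun s => \sum_i F i s) t (\sum_i D i).
Proof.
elim: n F D => [|n IH] F D dF.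
  by apply: cderiv_ext (cderiv_cst 0 t) => [s|]; rewrite big_ord0.
apply: cderiv_ext (cderivD (IH _ _ (fun i => dF (widen_ord (leqnSn n) i))) (dF ord_max)).
- by move=> s; rewrite big_ord_recr.
- by rewrite big_ord_recr.
Qed.

Lemma cderiv_unique f t a b : cderiv f t a -> cderiv f t b -> a = b.
Proof.
move=> [f1 f2] [g1 g2]; apply: complex_eq.
- by rewrite -(@derive_val _ _ _ _ _ _ _ f1) -(@derive_val _ _ _ _ _ _ _ g1).
- by rewrite -(@derive_val _ _ _ _ _ _ _ f2) -(@derive_val _ _ _ _ _ _ _ g2).
Qed.

(** For square matrices this unfolds to [has_mderiv]. Rectangular shapes are allowed because the
    Cholesky recursion differentiates the blocks of a matrix separately. *)
Definition mderiv m n (F : R -> 'M[C]_(m, n)) (t : R) (D : 'M[C]_(m, n)) : Prop :=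
  forall i j, cderiv (fun s => F s i j) t (D i j).

Definition mderivable m n (F : R -> 'M[C]_(m, n)) : Prop :=
  forall t, exists D, mderiv F t D.

(* On square matrices [adj] is convertible to [ctrans]. *)
Definition adj m n (A : 'M[C]_(m, n)) : 'M[C]_(n, m) := (map_mx (@conjc R) A)^T.

Lemma mderiv_ext m n (F G : R -> 'M[C]_(m, n)) t A B :
  F =1 G -> A = B -> mderiv F t A -> mderiv G t B.
Proof. by move=> /funext -> ->. Qed.

Lemma mderiv_cst m n (A : 'M[C]_(m, n)) t : mderiv (fun _ => A) t 0.
Proof. by move=> i j; rewrite mxE; apply: cderiv_cst. Qed.

Lemma mderivD m n (F G : R -> 'M[C]_(m, n)) t A B :
  mderiv F t A -> mderiv G t B -> mderiv (fun s => F s + G s) t (A + B).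
Proof.
move=> dF dG i j.
by apply: cderiv_ext (cderivD (dF i j) (dG i j)) => [s|]; rewrite mxE.
Qed.

Lemma mderivN m n (F : R -> 'M[C]_(m, n)) t A :
  mderiv F t A -> mderiv (fun s => - F s) t (- A).
Proof.
by move=> dF i j; apply: cderiv_ext (cderivN (dF i j)) => [s|]; rewrite mxE.
Qed.

Lemma mderivM m n p (F : R -> 'M[C]_(m, n)) (G : R -> 'M[C]_(n, p)) t A B :
  mderiv F t A -> mderiv G t B ->
  mderiv (fun s => F s *m G s) t (A *m G t + F t *m B).
Proof.
move=> dF dG i j.
apply: cderiv_ext (cderiv_sum (fun k => cderivM (dF i k) (dG k j))) => [s|].
  by rewrite mxE.
by rewrite !mxE -big_split.
Qed.

Lemma mderiv_adj m n (F : R -> 'M[C]_(m, n)) t A :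
  mderiv F t A -> mderiv (fun s => adj (F s)) t (adj A).
Proof.
by move=> dF i j; apply: cderiv_ext (cderiv_conj (dF j i)) => [s|]; rewrite !mxE.
Qed.

Lemma mderiv_unique m n (F : R -> 'M[C]_(m, n)) t A B :
  mderiv F t A -> mderiv F t B -> A = B.
Proof. by move=> dA dB; apply/matrixP => i j; apply: cderiv_unique (dA i j) (dB i j). Qed.

Lemma mderiv_block m1 m2 n1 n2 (F1 : R -> 'M[C]_(m1, n1)) (F2 : R -> 'M[C]_(m1, n2))
    (F3 : R -> 'M[C]_(m2, n1)) (F4 : R -> 'M[C]_(m2, n2)) t A1 A2 A3 A4 :
  mderiv F1 t A1 -> mderiv F2 t A2 -> mderiv F3 t A3 -> mderiv F4 t A4 ->
  mderiv (fun s => block_mx (F1 s) (F2 s) (F3 s) (F4 s)) t (block_mx A1 A2 A3 A4).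
Proof.
move=> d1 d2 d3 d4 i j.
case: (split_ordP i) => i' ->; case: (split_ordP j) => j' ->.
- by apply: cderiv_ext (d1 i' j') => [s|]; rewrite block_mxEul.
- by apply: cderiv_ext (d2 i' j') => [s|]; rewrite block_mxEur.
- by apply: cderiv_ext (d3 i' j') => [s|]; rewrite block_mxEdl.
- by apply: cderiv_ext (d4 i' j') => [s|]; rewrite block_mxEdr.
Qed.

Lemma mderiv_dlsub m1 m2 n1 n2 (F : R -> 'M[C]_(m1 + m2, n1 + n2)) t A :
  mderiv F t A -> mderiv (fun s => dlsubmx (F s)) t (dlsubmx A).
Proof. by move=> dF i j; apply: cderiv_ext (dF _ _) => [s|]; rewrite !mxE. Qed.

Lemma mderiv_drsub m1 m2 n1 n2 (F : R -> 'M[C]_(m1 + m2, n1 + n2)) t A :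
  mderiv F t A -> mderiv (fun s => drsubmx (F s)) t (drsubmx A).
Proof. by move=> dF i j; apply: cderiv_ext (dF _ _) => [s|]; rewrite !mxE. Qed.

Lemma mderiv_scalar n (f : R -> C) t a :
  cderiv f t a -> mderiv (fun s => (f s)%:M : 'M[C]_n) t a%:M.
Proof.
move=> df i j; rewrite mxE; case: eqP => [->|/eqP ij].
  by apply: cderiv_ext df => [s|]; rewrite ?mxE ?eqxx.
by apply: cderiv_ext (cderiv_cst 0 t) => [s|]; rewrite ?mxE ?(negbTE ij).
Qed.

Lemma adjE m n (A : 'M[C]_(m, n)) i j : adj A i j = conjc (A j i).
Proof. by rewrite !mxE. Qed.

Lemma adjK m n (A : 'M[C]_(m, n)) : adj (adj A) = A.
Proof. by apply/matrixP => i j; rewrite !adjE conjcK. Qed.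

Lemma adjM m n p (A : 'M[C]_(m, n)) (B : 'M[C]_(n, p)) :
  adj (A *m B) = adj B *m adj A.
Proof. by rewrite /adj map_mxM trmx_mul. Qed.

Lemma adjD m n (A B : 'M[C]_(m, n)) : adj (A + B) = adj A + adj B.
Proof. by rewrite /adj map_mxD linearD. Qed.

Lemma adjN m n (A : 'M[C]_(m, n)) : adj (- A) = - adj A.
Proof. by rewrite /adj map_mxN linearN. Qed.

Lemma adj_mx1 n : adj (1%:M : 'M[C]_n) = 1%:M.
Proof. by rewrite /adj map_mx1 trmx1. Qed.

Lemma adj_mx0 m n : adj (0 : 'M[C]_(m, n)) = 0.
Proof. by rewrite /adj map_mx0 trmx0. Qed.

Lemma adj_scalar n (a : C) : adj (a%:M : 'M[C]_n) = (conjc a)%:M.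
Proof. by rewrite /adj map_scalar_mx tr_scalar_mx. Qed.

Lemma adj_block m1 m2 n1 n2 (A : 'M[C]_(m1, n1)) (B : 'M[C]_(m1, n2))
    (D : 'M[C]_(m2, n1)) (E : 'M[C]_(m2, n2)) :
  adj (block_mx A B D E) = block_mx (adj A) (adj D) (adj B) (adj E).
Proof. by rewrite /adj map_block_mx tr_block_mx. Qed.

Lemma tr_adj n (A : 'M[C]_n) : \tr (adj A) = conjc (\tr A).
Proof.
by rewrite /mxtrace rmorph_sum /=; apply: eq_bigr => i _; rewrite adjE.
Qed.

Lemma det_adj n (A : 'M[C]_n) : \det (adj A) = conjc (\det A).
Proof. by rewrite det_tr det_map_mx. Qed.

End Calculus.

(** * Differentiable Cholesky factorization and its uniqueness *)

Section Cholesky.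
Variable R : realType.
Local Notation C := R[i].

Lemma mderivZ m n (f : R -> C) (F : R -> 'M[C]_(m, n)) t a A :
  cderiv f t a -> mderiv F t A ->
  mderiv (fun s => f s *: F s) t (a *: F t + f t *: A).
Proof.
move=> df dF i j.
by apply: cderiv_ext (cderivM df (dF i j)) => [s|]; rewrite !mxE.
Qed.

Lemma adjZ m n (a : C) (A : 'M[C]_(m, n)) : adj (a *: A) = conjc a *: adj A.
Proof. by apply/matrixP => i j; rewrite !mxE rmorphM. Qed.

(** The group U without its determinant condition, which would not pass to diagonal blocks in an
    induction on the size. In the order of [C], [0 < z] already says that [z] is real. *)
Definition upos n (V : 'M[C]_n) : Prop :=
  (forall i j : 'I_n, (j < i)%N -> V i j = 0) /\ (forall i, 0 < V i i).

Definition posdef n (P : 'M[C]_n) : Prop :=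
  adj P = P /\ forall x : 'cV[C]_n, x != 0 -> 0 < (adj x *m P *m x) 0 0.

Lemma upos_block n (a : C) (r : 'rV[C]_n) (V : 'M[C]_n) :
  0 < a -> upos V -> upos (block_mx (a%:M : 'M[C]_1) r 0 V).
Proof.
move=> a0 [V0 Vp]; split=> [i j|i].
  case: (split_ordP i) => i' ->; case: (split_ordP j) => j' -> /=.
  - by rewrite !ord1.
  - by rewrite ord1.
  - by rewrite block_mxEdl mxE.
  - by rewrite block_mxEdr => ?; apply: V0.
case: (split_ordP i) => i' ->; last by rewrite block_mxEdr.
by rewrite block_mxEul !ord1 mxE eqxx.
Qed.

Lemma upos_drsub n (V : 'M[C]_(1 + n)) : upos V ->
  upos (drsubmx V) /\
  exists2 a : C, 0 < a & V = block_mx a%:M (ursubmx V) 0 (drsubmx V).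
Proof.
move=> [V0 Vp]; split.
  by split=> [i j ij|i]; rewrite !mxE; [apply: V0|apply: Vp].
exists (V 0 0); first exact: Vp.
rewrite -[LHS]submxK; congr block_mx; apply/matrixP => i j; rewrite !mxE !ord1.
  by rewrite eqxx; congr (V _ _); apply: val_inj.
exact: V0.
Qed.

(** One elimination step. The form of the Schur complement at [x] is the form of [P] at a vector
    extending [x], so positivity is inherited. *)
Lemma posdef_schur n (P : 'M[C]_(1 + n)) : posdef P ->
  exists a : R, [/\ 0 < a,
    P = block_mx a%:C%:M (adj (dlsubmx P)) (dlsubmx P) (drsubmx P) &
    posdef (drsubmx P - (a^-1)%:C *: (dlsubmx P *m adj (dlsubmx P)))].
Proof.
move=> [Ph Pp].
set b := dlsubmx P; set S := drsubmx P.
have : 0 < P 0 0.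
  have := Pp (delta_mx 0 0); rewrite {1}/adj map_delta_mx trmx_delta -rowE -colE !mxE.
  apply; apply/eqP => /matrixP/(_ 0 0); rewrite !mxE !eqxx /=.
  exact/eqP/oner_neq0.
move=> /gt0_real_complex[P00 a0]; exists (Re (P 0 0)).
have PE : P = block_mx (Re (P 0 0))%:C%:M (adj b) b S.
  rewrite -[LHS]submxK; congr block_mx; last first.
    by rewrite -{1}Ph; apply/matrixP=> i j; rewrite !mxE.
  apply/matrixP=> i j; rewrite !mxE !ord1 eqxx -P00.
  by congr (P _ _); apply: val_inj.
set a := Re _ in PE a0 *.
have Sh : adj S = S by move: Ph; rewrite PE adj_block => /eq_block_mx[].
split => //; split; first by rewrite adjD adjN adjZ conjc_real adjM adjK Sh.
move=> x x0.
(* The first coordinate is chosen so that the first entry of [P *m y] vanishes. *)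
pose y : 'cV[C]_(1 + n) := col_mx (- (a^-1)%:C *: (adj b *m x)) x.
have -> : adj x *m (S - (a^-1)%:C *: (b *m adj b)) *m x = adj y *m P *m y.
  rewrite -!mulmxA PE /y mul_block_col /adj map_col_mx tr_col_mx mul_row_col.
  rewrite mul_scalar_mx scalerA mulrN -rmorphM mulfV ?gt_eqF// rmorph1 scaleN1r addNr.
  rewrite mulmx0 add0r mulmxBl -scalemxAr -scalemxAl mulmxA.
  by rewrite addrC scaleNr.
apply: Pp; apply: contraNneq x0 => y0.
rewrite -[x](col_mxKd (- (a^-1)%:C *: (adj b *m x))) -/y y0.
by apply/eqP/matrixP => i j; rewrite !mxE.
Qed.

(** Induction through the Schur complement: only the square root and the inverse of the positive
    pivot [a] occur, and both are differentiable. The inverse [W] is built along with [V], so its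
    differentiability comes from the same recursion. *)
Lemma cholesky_smooth n (P : R -> 'M[C]_n) :
  mderivable P -> (forall t, posdef (P t)) ->
  exists V W : R -> 'M[C]_n, [/\ mderivable V, mderivable W &
    forall t, [/\ upos (V t), upos (W t), V t *m W t = 1%:M & adj (V t) *m V t = P t]].
Proof.
elim: n P => [|n IH]; last rewrite -[n.+1]/(1 + n)%N; move=> P dP Pp.
  exists (fun=> 1%:M), (fun=> 1%:M); split.
  - by move=> t; exists 0; apply: mderiv_cst.
  - by move=> t; exists 0; apply: mderiv_cst.
  - by move=> t; split; try (by split=> -[]); rewrite [LHS]flatmx0 [RHS]flatmx0.
have [a aP] := choice (fun t => posdef_schur (Pp t)).
pose b t := dlsubmx (P t : 'M[C]_(1 + n)).
pose S t := drsubmx (P t : 'M[C]_(1 + n)).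
have a0 t : 0 < a t by case: (aP t).
have PE t : P t = block_mx (a t)%:C%:M (adj (b t)) (b t) (S t) by case: (aP t).
have da t : exists d, is_derive t (1 : R) a d.
  have [D /(_ (lshift n (0 : 'I_1)) (lshift n (0 : 'I_1)))[d _]] := dP t.
  by eexists; apply: is_derive_ext d => // s; rewrite PE block_mxEul mxE eqxx.
have db t : exists D, mderiv b t D.
  by have [D dD] := dP t; exists (dlsubmx (D : 'M[C]_(1 + n))); apply: mderiv_dlsub.
have dS t : exists D, mderiv S t D.
  by have [D dD] := dP t; exists (drsubmx (D : 'M[C]_(1 + n))); apply: mderiv_drsub.
have daV t : exists d, cderiv (fun s => ((a s)^-1)%:C) t d.
  have [d dd] := da t; exists (- (a t) ^- 2 *: d)%:C; apply: cderiv_real.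
  by apply: is_deriveV => //; rewrite gt_eqF.
pose r t := Num.sqrt (a t).
have r0 t : 0 < r t by rewrite sqrtr_gt0.
have dr t : exists d, is_derive t (1 : R) r d.
  have [d dd] := da t; exists ((2 * Num.sqrt (a t))^-1 * d).
  exact: (@is_derive1_comp _ (@Num.sqrt R) a t _ _ (is_derive1_sqrt (a0 t)) dd).
have drV t : exists d, cderiv (fun s => ((r s)^-1)%:C) t d.
  have [d dd] := dr t; exists (- (r t) ^- 2 *: d)%:C; apply: cderiv_real.
  by apply: is_deriveV => //; rewrite gt_eqF.
have rr t : (r t)%:C * (r t)%:C = (a t)%:C.
  by rewrite -rmorphM -expr2 sqr_sqrtr// ltW.
have rK t : (r t)%:C * ((r t)^-1)%:C = 1 by rewrite -rmorphM mulfV ?gt_eqF.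
have rrV t : ((r t)^-1)%:C * ((r t)^-1)%:C = ((a t)^-1)%:C.
  by rewrite -rmorphM -invfM -expr2 sqr_sqrtr// ltW.
have [|t|V [W [dV dW VW]]] := IH (fun t => S t - ((a t)^-1)%:C *: (b t *m adj (b t))).
- move=> t; have [d1 h1] := daV t; have [d2 h2] := db t; have [d3 h3] := dS t.
  eexists; apply: mderivD h3 (mderivN (mderivZ h1 (mderivM h2 (mderiv_adj h2)))).
- by case: (aP t).
(* With [r] the square root of [a], the first row of [V] is forced by the first row of [P], and the
   product of its off-diagonal parts is the term subtracted in the Schur complement. The corner of
   [W] solves [V *m W = 1], using that [r / a] is the inverse of [r]. *)
exists (fun t => block_mx (r t)%:C%:M (((r t)^-1)%:C *: adj (b t)) 0 (V t)).
exists (fun t => block_mx ((r t)^-1)%:C%:M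
  (- (((a t)^-1)%:C *: (adj (b t) *m W t))) 0 (W t)).
split=> t.
- have [d1 h1] := dr t; have [d2 h2] := db t; have [d3 h3] := dV t.
  have [d4 h4] := drV t.
  eexists; apply: mderiv_block (mderiv_scalar (cderiv_real h1)) _ (mderiv_cst 0 t) h3.
  exact: mderivZ h4 (mderiv_adj h2).
- have [d1 h1] := daV t; have [d2 h2] := db t; have [d3 h3] := dW t.
  have [d4 h4] := drV t.
  eexists; apply: mderiv_block (mderiv_scalar h4) _ (mderiv_cst 0 t) (h3).
  exact: mderivN (mderivZ h1 (mderivM (mderiv_adj h2) h3)).
have [Vu Wu VWE VVE] := VW t; split.
- by apply: upos_block => //; rewrite ltcR.
- by apply: upos_block => //; rewrite ltcR invr_gt0.
- rewrite mulmx_block !mulmx0 !mul0mx !addr0 !add0r VWE.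
  rewrite mul_scalar_mx scale_scalar_mx rK mul_scalar_mx scalerN scalerA.
  rewrite -scalemxAl -rrV mulrA rK mul1r addNr.
  by rewrite [RHS](scalar_mx_block 1 n).
- rewrite adj_block mulmx_block !adj_mx0 !mulmx0 !mul0mx !addr0 VVE.
  rewrite !adjZ adjK !adj_scalar !conjc_real !mul_scalar_mx mul_mx_scalar.
  rewrite scale_scalar_mx rr !scalerA rK !scale1r -scalemxAl -scalemxAr scalerA rrV.
  by rewrite addrC subrK PE.
Qed.

(** Blocks are compared in turn: the corner fixes the square of the positive pivot, the first column
    then fixes the rest of the first row, and after cancelling these the lower blocks satisfy the
    same equation. *)
Lemma cholesky_unique n (V W : 'M[C]_n) :
  upos V -> upos W -> adj V *m V = adj W *m W -> V = W.
Proof.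
elim: n V W => [|n IH]; last rewrite -[n.+1]/(1 + n)%N; move=> V W.
  by rewrite [V]flatmx0 [W]flatmx0.
move=> /(@upos_drsub n)[Vu [a a0 ->]] /(@upos_drsub n)[Wu [c c0 ->]].
move: (ursubmx _) (drsubmx _) Vu (ursubmx _) (drsubmx _) Wu => r V' Vu s W' Wu.
rewrite !adj_block !mulmx_block !adj_mx0 !mulmx0 !mul0mx !addr0 !adj_scalar !conjc_gt0//.
rewrite !mul_scalar_mx !mul_mx_scalar !scale_scalar_mx => /eq_block_mx[].
move=> /matrixP/(_ 0 0); rewrite !mxE eqxx !mulr1n -!expr2 => ac.
have {}ac : a = c by apply/eqP; rewrite -(@eqrXn2 _ 2) ?ltW// ac.
rewrite -{c}ac in c0 *; move=> /(can_inj (scalerK _)); rewrite gt_eqF// => /(_ isT) <- _.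
by move=> /addrI /IH ->.
Qed.

End Cholesky.

(** * QR factorization with a unitary and an upper positive factor *)

Section QR.
Variable R : realType.
Local Notation C := R[i].

Definition unitary n (Q : 'M[C]_n) : Prop := adj Q *m Q = 1%:M.

Lemma unitary_adjr n (Q : 'M[C]_n) : unitary Q -> Q *m adj Q = 1%:M.
Proof. exact: mulmx1C. Qed.

Lemma unitary_unit n (Q : 'M[C]_n) : unitary Q -> Q \in unitmx.
Proof. by move=> /mulmx1_unit[]. Qed.

Lemma unitary_inv n (Q : 'M[C]_n) : unitary Q -> invmx Q = adj Q.
Proof.
by move=> QU; rewrite -[LHS]mul1mx -QU mulmxK// unitary_unit.
Qed.

Lemma unitaryM n (P Q : 'M[C]_n) : unitary P -> unitary Q -> unitary (P *m Q).
Proof.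
by rewrite /unitary => PU QU; rewrite adjM -mulmxA (mulmxA _ P) PU mul1mx.
Qed.

Lemma unitary_adj n (Q : 'M[C]_n) : unitary Q -> unitary (adj Q).
Proof. by move=> QU; rewrite /unitary adjK unitary_adjr. Qed.

Lemma unitary_invmx n (Q : 'M[C]_n) : unitary Q -> unitary (invmx Q).
Proof. by move=> QU; rewrite unitary_inv//; apply: unitary_adj. Qed.

Lemma inK_unitary n (Q : 'M[C]_n) : inK Q -> unitary Q.
Proof. by case=> /mulmx1C. Qed.

Lemma inU_upos n (V : 'M[C]_n) : inU V -> upos V.
Proof.
move=> [V0 [Vd _]]; split => // i; have [Vi Vr] := Vd i.
by rewrite ltcE /= Vi eqxx.
Qed.

Lemma upos_det_gt0 n (V : 'M[C]_n) : upos V -> 0 < \det V.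
Proof.
move=> [V0 Vp]; rewrite -det_tr det_trig; last first.
  by apply/is_trig_mxP => i j ij; rewrite mxE V0.
by apply: prodr_gt0 => i _; rewrite mxE.
Qed.

Lemma upos_unitmx n (V : 'M[C]_n) : upos V -> V \in unitmx.
Proof. by move=> /upos_det_gt0 V0; rewrite unitmxE unitfE gt_eqF. Qed.

Lemma uposM n (V W : 'M[C]_n) : upos V -> upos W -> upos (V *m W).
Proof.
move=> [V0 Vp] [W0 Wp]; split=> [i j ji|i]; rewrite mxE.
  apply: big1 => k _; case: (ltnP k i) => [ki|ik]; first by rewrite V0// mul0r.
  by rewrite W0 ?mulr0// (leq_trans ji).
rewrite (bigD1 i)//= big1 ?addr0 ?mulr_gt0// => k ki.
case: (ltngtP k i) => [?|?|/val_inj ki']; first by rewrite V0// mul0r.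
  by rewrite W0 ?mulr0.
by rewrite ki' eqxx in ki.
Qed.

Lemma gram_posdef n (g : 'M[C]_n) : g \in unitmx -> posdef (adj g *m g).
Proof.
move=> gU; split=> [|x x0]; first by rewrite adjM adjK.
have -> : adj x *m (adj g *m g) *m x = adj (g *m x) *m (g *m x).
  by rewrite adjM !mulmxA.
have : g *m x != 0.
  by apply: contraNneq x0 => gx; rewrite -[x](mulKmx gU) gx mulmx0.
move: (g *m x) => y y0; rewrite mxE.
have ge0 i : 0 <= adj y 0 i * y i 0 by rewrite adjE mulrC mulcJ_ge0.
rewrite lt_def sumr_ge0 // andbT; apply: contraNneq y0 => /psumr_eq0P y0.
apply/eqP/matrixP => i j; rewrite ord1 mxE; apply/eqP.
have /eqP := y0 (fun i _ => ge0 i) i isT.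
by rewrite adjE mulf_eq0 conjc_eq0 orbb.
Qed.

(** [V] is the Cholesky factor of the Gram matrix of [g]; then [g] and [V] have the same Gram
    matrix, which makes [g *m W] unitary. *)
Lemma qr_smooth n (g : R -> 'M[C]_n) :
  mderivable g -> (forall t, g t \in unitmx) ->
  exists V W : R -> 'M[C]_n, [/\ mderivable V, mderivable W &
    forall t, [/\ upos (V t), upos (W t), V t *m W t = 1%:M & unitary (g t *m W t)]].
Proof.
move=> dg gU.
have [t|t|V [W [dV dW VW]]] := @cholesky_smooth R n (fun t => adj (g t) *m g t).
- by have [D dD] := dg t; eexists; apply: mderivM (mderiv_adj dD) dD.
- exact: gram_posdef.
exists V, W; split => // t; have [Vu Wu VW1 VV] := VW t; split => //.
rewrite /unitary adjM -mulmxA (mulmxA (adj (g t))) -VV -mulmxA VW1 mulmx1.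
by rewrite -adjM VW1 adj_mx1.
Qed.

(** The unitary factors drop out of the Gram matrices, which leaves uniqueness of the Cholesky
    factor. *)
Lemma qr_unique n (Q Q' V V' : 'M[C]_n) :
  unitary Q -> unitary Q' -> upos V -> upos V' -> Q *m V = Q' *m V' ->
  Q = Q' /\ V = V'.
Proof.
move=> QU QU' Vu Vu' E.
have VV : V = V'.
  apply: cholesky_unique => //.
  have gram (P U : 'M[C]_n) : unitary P -> adj U *m U = adj (P *m U) *m (P *m U).
    by move=> PU; rewrite adjM -mulmxA (mulmxA (adj P)) PU mul1mx.
  by rewrite (gram Q V)// (gram Q' V')// E.
split => //; rewrite -VV in E.
by rewrite -[LHS](mulmxK (upos_unitmx Vu)) E mulmxK// upos_unitmx.
Qed.

Lemma inL_det n (l : 'M[C]_n) : inL l -> \det l = 1.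
Proof.
move=> [l0 l1]; rewrite det_trig; last by apply/is_trig_mxP.
by apply: big1 => i _.
Qed.

Lemma inL_unit n (l : 'M[C]_n) : inL l -> l \in unitmx.
Proof. by move=> /inL_det l1; rewrite unitmxE l1 unitr1. Qed.

(** The QR factors have determinant one separately: their determinants multiply to 1, that of [V] is
    positive and that of [Q] has modulus 1, so both equal 1. *)
Lemma inL_KU n (l : 'M[C]_n) : inL l -> exists k v, is_KU l k v.
Proof.
move=> lL; have lU := inL_unit lL.
(* A single matrix is factored as a constant curve, evaluated at time 0. *)
have [t|//|V [W [_ _ /(_ 0)[Vu Wu VW lW]]]] := @qr_smooth n (fun=> l).
  by exists 0; apply: mderiv_cst.
have WV := mulmx1C VW.
have d1 : \det (l *m W 0) * \det (V 0) = 1.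
  by rewrite -det_mulmx -mulmxA WV mulmx1 inL_det.
have d2 : conjc (\det (l *m W 0)) * \det (l *m W 0) = 1.
  by rewrite -det_adj -det_mulmx lW det1.
have dV := upos_det_gt0 Vu.
have dK : conjc (\det (l *m W 0)) = \det (l *m W 0).
  have -> : \det (l *m W 0) = (\det (V 0))^-1.
    by rewrite -[RHS]mul1r -d1 mulfK ?gt_eqF.
  by rewrite conjc_inv conjc_gt0.
have dV1 : \det (V 0) = 1.
  apply/eqP; rewrite -(@eqrXn2 _ 2) ?ltW ?ltr01//; apply/eqP.
  by rewrite expr1n -[LHS]mul1r -[X in X * _]d2 dK -expr2 -exprMn d1 expr1n.
rewrite dV1 mulr1 in d1.
exists (l *m W 0), (V 0); split; first by split => //; apply: unitary_adjr.
split; last by rewrite -mulmxA WV mulmx1.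
split; first by case: Vu.
split=> // i; case: Vu => _ /(_ i).
by rewrite ltcE /= => /andP[/eqP].
Qed.

End QR.

(** * Gronwall estimates and uniqueness of Toda trajectories *)

Section Uniqueness.
Variable R : realType.
Local Notation C := R[i].

Lemma derive_le0_nonincreasing (h h' : R -> R) (x y : R) :
  (forall s, is_derive s (1 : R) h (h' s)) -> (forall s, h' s <= 0) ->
  x <= y -> h y <= h x.
Proof.
move=> dh h0 xy; rewrite -subr_le0.
have [|z _ ->] := MVT_segment xy (fun s _ => dh s).
  apply/continuous_subspaceT => r.
  by apply/differentiable_continuous/derivable1_diffP; case: (dh r).
by rewrite mulr_le0_ge0 ?subr_ge0.
Qed.

(** The function [f s * expR (- K * s)] is nonincreasing and vanishes at 0. *)
Lemma gronwall_ge0 (f f' : R -> R) (K t : R) :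
  (forall s, is_derive s (1 : R) f (f' s)) -> (forall s, f' s <= K * f s) ->
  f 0 = 0 -> 0 <= t -> f t <= 0.
Proof.
move=> df fK f0 t0.
have de s : is_derive s (1 : R) (fun s => expR (- K * s)) (expR (- K * s) * - K).
  apply: (@is_derive1_comp _ expR ( *%R (- K))).
  have := is_deriveZ (- K) (is_derive_id s (1 : R)).
  by apply: is_derive_ext => //; rewrite /GRing.scale /= mulr1.
have := @derive_le0_nonincreasing (fun s => f s * expR (- K * s)) _ 0 t
  (fun s => is_deriveM (df s) (de s)).
rewrite f0 mul0r pmulr_lle0 ?expR_gt0//; apply=> // s.
rewrite /GRing.scale /= [X in X <= _](_ : _ = expR (- K * s) * (f' s - K * f s)).
  by rewrite pmulr_rle0 ?expR_gt0// subr_le0.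
by ring.
Qed.

(** Negative times reduce to positive ones by the reflection [s] to [- s]; this is why the bound is
    on the absolute value of [f']. *)
Lemma gronwall (f f' : R -> R) (K t : R) :
  (forall s, is_derive s (1 : R) f (f' s)) -> (forall s, `|f' s| <= K * f s) ->
  f 0 = 0 -> f t <= 0.
Proof.
move=> df fK f0; case: (leP 0 t) => t0.
  by apply: (gronwall_ge0 df _ f0 t0) => s; apply: le_trans (ler_norm _) (fK s).
have df' s : is_derive s (1 : R) (fun s => f (- s)) (f' (- s) * -1).
  exact: (@is_derive1_comp _ f -%R).
have := @gronwall_ge0 (fun s => f (- s)) _ K (- t) df'.
rewrite oppr0 opprK; apply=> //; last by rewrite oppr_ge0 ltW.
by move=> s; rewrite mulrN1; apply: le_trans (ler_norm _) _; rewrite normrN fK.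
Qed.

(** The real Frobenius inner product, that is, the Euclidean one on the real and imaginary parts of
    the entries. *)
Definition ip n (A B : 'M[C]_n) : R := Re (\tr (adj A *m B)).

Lemma ipDr n (A B D : 'M[C]_n) : ip A (B + D) = ip A B + ip A D.
Proof. by rewrite /ip mulmxDr linearD /= cReD. Qed.

Lemma ip_sym n (A B : 'M[C]_n) : ip A B = ip B A.
Proof. by rewrite /ip -cReJ -tr_adj adjM adjK. Qed.

Lemma ipxx n (A : 'M[C]_n) : ip A A = \sum_i \sum_j (Re (A j i) ^+ 2 + Im (A j i) ^+ 2).
Proof.
rewrite /ip /mxtrace Re_sum; apply: eq_bigr => i _; rewrite mxE Re_sum.
by apply: eq_bigr => j _; rewrite adjE cReM cReJ cImJ mulNr opprK !expr2.
Qed.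

Lemma ip_ge0 n (A : 'M[C]_n) : 0 <= ip A A.
Proof.
by rewrite ipxx; do 2!apply: sumr_ge0 => ? _; rewrite addr_ge0 ?sqr_ge0.
Qed.

Lemma norm_entry_le n (A : 'M[C]_n) i j : `|A i j| <= (Num.sqrt (ip A A))%:C.
Proof.
rewrite normc_def lecR ler_wsqrtr// ipxx (bigD1 j)//= (bigD1 i)//= -addrA lerDl.
by rewrite addr_ge0//; do ?[apply: sumr_ge0 => ? _]; rewrite addr_ge0 ?sqr_ge0.
Qed.

Lemma ip_eq0 n (A : 'M[C]_n) : ip A A = 0 -> A = 0.
Proof.
move=> A0; apply/matrixP => i j; rewrite mxE; apply/eqP.
by rewrite -normr_le0; have := norm_entry_le A i j; rewrite A0 sqrtr0.
Qed.

(** Both terms are traces of a Hermitian matrix times the skew-Hermitian [A], with [adj D *m D] or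
    [D *m adj D] as the Hermitian factor, and such traces are purely imaginary. *)
Lemma ip_skew_commutator n (D A : 'M[C]_n) :
  adj A = - A -> ip D (D *m A - A *m D) = 0.
Proof.
move=> Ask.
have H (S : 'M[C]_n) : adj S = S -> Re (\tr (S *m A)) = 0.
  move=> Sh; have /(congr1 (@complex.Re _)) := tr_adj (S *m A).
  rewrite cReJ adjM Ask Sh mulNmx linearN /= cReN mxtrace_mulC => /eqP.
  by rewrite eq_sym -addr_eq0 -mulr2n mulrn_eq0 => /eqP.
rewrite /ip mulmxBr linearB /= cReD cReN mulmxA H ?adjM ?adjK// mxtrace_mulC.
by rewrite -mulmxA mxtrace_mulC H ?adjM ?adjK// subrr.
Qed.

Lemma norm_mulmx_le n (A B : 'M[C]_n) (a b : C) :
  (forall i j, `|A i j| <= a) -> (forall i j, `|B i j| <= b) ->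
  forall i j, `|(A *m B) i j| <= n%:R * (a * b).
Proof.
move=> Aa Bb i j; rewrite mxE; apply: le_trans (ler_norm_sum _ _ _) _.
rewrite -[n in leRHS]card_ord mulr_natl -sumr_const; apply: ler_sum => k _.
by rewrite normrM ler_pM.
Qed.

Lemma norm_trace_le n (A : 'M[C]_n) (a : C) :
  (forall i j, `|A i j| <= a) -> `|\tr A| <= n%:R * a.
Proof.
move=> Aa; apply: le_trans (ler_norm_sum _ _ _) _.
by rewrite -[n in leRHS]card_ord mulr_natl -sumr_const; apply: ler_sum.
Qed.

Lemma ip_commutator_le n (D G A : 'M[C]_n) (c d : R) :
  (forall i j, `|D i j| <= d%:C) -> (forall i j, `|G i j| <= c%:C) ->
  (forall i j, `|A i j| <= d%:C) ->
  `|ip D (G *m A - A *m G)| <= (n%:R ^+ 3 * c *+ 2) * d ^+ 2.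
Proof.
move=> Dd Gc Ad; rewrite -lecR; apply: le_trans (normc_ge_Re _) _.
have H i j : `|(G *m A - A *m G) i j| <= n%:R * (c%:C * d%:C) *+ 2.
  rewrite mxE mulr2n; apply: le_trans (ler_normD _ _) _.
  rewrite lerD ?norm_mulmx_le// mxE normrN [X in _ * X]mulrC.
  exact: norm_mulmx_le.
have Dd' i j : `|adj D i j| <= d%:C by rewrite adjE normcJ.
apply: le_trans (norm_trace_le (norm_mulmx_le Dd' H)) _.
rewrite le_eqVlt; apply/orP; left; apply/eqP.
by rewrite !(rmorphM, rmorphXn, rmorphMn, rmorph_nat) /=; ring.
Qed.

Lemma is_derive_ip n (F G : R -> 'M[C]_n) t A B :
  mderiv F t A -> mderiv G t B ->
  is_derive t (1 : R) (fun s => ip (F s) (G s)) (ip A (G t) + ip (F t) B).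
Proof.
move=> dF dG; have dM := mderivM (mderiv_adj dF) dG.
have [] := cderiv_sum (fun i => dM i i).
by move=> d _; apply: is_derive_ext d => [//|]; rewrite /ip -cReD -linearD.
Qed.

(** Below the diagonal [A] agrees with [X], above it [A] is minus the conjugate of the mirrored
    entry, and on the diagonal it keeps only the imaginary part of [X]. *)
Lemma proj_k_le n (X A : 'M[C]_n) (d : C) :
  proj_k X A -> (forall i j, `|X i j| <= d) -> forall i j, `|A i j| <= d.
Proof.
move=> [[Ask _] [XA0 [XAi _]]] Xd i j.
have low (i' j' : 'I_n) : (j' < i')%N -> A i' j' = X i' j'.
  by move=> /XA0; rewrite !mxE => /eqP; rewrite subr_eq0 => /eqP <-.
have sk i' j' : A i' j' = - conjc (A j' i').
  by rewrite -adjE [adj A]Ask mxE opprK.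
case: (ltngtP i j) => [ij|ji|/val_inj <-].
- by rewrite sk normrN normcJ low.
- by rewrite low.
- apply: le_trans (Xd i i).
  have := congr1 (@complex.Re _) (sk i i); rewrite cReN cReJ => /eqP.
  rewrite -addr_eq0 -mulr2n mulrn_eq0 => /eqP Ar.
  have := XAi i; rewrite !mxE cImD cImN => /eqP; rewrite subr_eq0 => /eqP Ai.
  by rewrite !normc_def lecR ler_wsqrtr// Ar -Ai expr0n lerD2r sqr_ge0.
Qed.

Lemma proj_kB n (X X' A A' : 'M[C]_n) :
  proj_k X A -> proj_k X' A' -> proj_k (X - X') (A - A').
Proof.
move=> [[a1 a2] [b1 [b2 b3]]] [[c1 c2] [d1 [d2 d3]]]; split.
  split; last by rewrite linearB /= a2 c2 subr0.
  by move: a1 c1; rewrite -![ctrans _]/(adj _) adjD adjN => -> ->; rewrite opprD.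
have E : X - X' - (A - A') = (X - A) - (X' - A').
  by apply/matrixP => i j; rewrite !mxE; ring.
rewrite E; split=> [i j ij|]; first by rewrite mxE b1// mxE d1// subr0.
split=> [i|]; last by rewrite linearB /= b3 d3 subr0.
by rewrite mxE cImD b2 mxE cImN d2 oppr0 addr0.
Qed.

(** The velocity is a commutator of [G] with a skew-Hermitian matrix, hence orthogonal to [G]. *)
Lemma toda_ip_const n (G : R -> 'M[C]_n) t :
  toda_solution G -> ip (G t) (G t) = ip (G 0) (G 0).
Proof.
move=> sG; apply: (@is_derive_0_is_cst _ (fun s => ip (G s) (G s))) => s.
have [A [[[Ask _] _] dG]] := sG s.
apply: is_derive_ext (is_derive_ip dG dG) => //.
by rewrite ip_sym ip_skew_commutator// addr0.
Qed.

(* For the difference D of two solutions, D' = [D, pi_k F] + [G, pi_k D]; the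
   first bracket is orthogonal to D because pi_k F is skew-Hermitian, and G is
   bounded because the flow is isometric. *)
Lemma toda_unique n (F G : R -> 'M[C]_n) :
  toda_solution F -> toda_solution G -> F 0 = G 0 -> F =1 G.
Proof.
move=> sF sG FG0 t; apply/eqP; rewrite -subr_eq0; apply/eqP/ip_eq0.
pose D s := F s - G s; rewrite -/(D t).
pose c := Num.sqrt (ip (G 0) (G 0)).
have key s : exists d, is_derive s (1 : R) (fun r => ip (D r) (D r)) d /\
    `|d| <= (n%:R ^+ 3 * c *+ 2 *+ 2) * ip (D s) (D s).
  have [A [pA dF]] := sF s; have [B [pB dG]] := sG s.
  have dD : mderiv D s (F s *m A - A *m F s - (G s *m B - B *m G s)).
    exact: mderivD dF (mderivN dG).
  exists (ip (D s) (G s *m (A - B) - (A - B) *m G s) *+ 2); split.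
    apply: is_derive_ext (is_derive_ip dD dD) => //.
    rewrite ip_sym -mulr2n; congr (_ *+ 2).
    have -> : F s *m A - A *m F s - (G s *m B - B *m G s) =
      (D s *m A - A *m D s) + (G s *m (A - B) - (A - B) *m G s).
      rewrite /D !mulmxBl !mulmxBr.
      move: (F s *m A) (A *m F s) (G s *m A) (A *m G s) (G s *m B) (B *m G s).
      by move=> a1 a2 a3 a4 a5 a6; apply/matrixP => i j; rewrite !mxE; ring.
    by rewrite ipDr ip_skew_commutator ?add0r//; case: pA => -[].
  rewrite normrMn -[_ *+ 2 *+ 2]mulr_natr mulrAC mulr_natr lerMn2r /=.
  (* The Frobenius norm of [D s] serves as the common entry bound for [D s] and for its projection
     [A - B]. *)
  have -> : ip (D s) (D s) = Num.sqrt (ip (D s) (D s)) ^+ 2.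
    by rewrite sqr_sqrtr// ip_ge0.
  apply: ip_commutator_le; first exact: norm_entry_le.
    by move=> i j; rewrite /c -(toda_ip_const s sG); apply: norm_entry_le.
  exact/(proj_k_le (proj_kB pA pB))/norm_entry_le.
have [d dP] := choice key.
apply/eqP; rewrite eq_le ip_ge0 andbT.
apply: (@gronwall (fun r => ip (D r) (D r)) d) => [s|s|].
- by case: (dP s).
- by case: (dP s) => _; apply.
- by rewrite /D FG0 subrr /ip mulmx0 mxtrace0.
Qed.

End Uniqueness.

(** * The QR factorization of a flow solves the Toda equation *)

Section Flow.
Variable R : realType.
Local Notation C := R[i].

Lemma mderiv_entry_real n (V : R -> 'M[C]_n) t D i :
  (forall s, upos (V s)) -> mderiv V t D -> Im (D i i) = 0.
Proof.
move=> Vu /(_ i i)[_ d].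
have d0 : is_derive t (1 : R) (fun s => Im (V s i i)) 0.
  apply: is_derive_ext (is_derive_cst (0 : R) t (1 : R)) => // s.
  by case: (Vu s) => _ /(_ i); rewrite ltcE /= => /andP[/eqP->].
by rewrite -(@derive_val _ _ _ _ _ _ _ d) (@derive_val _ _ _ _ _ _ _ d0).
Qed.

Lemma mderiv_upper n (V : R -> 'M[C]_n) t D (i j : 'I_n) :
  (forall s, upos (V s)) -> mderiv V t D -> (j < i)%N -> D i j = 0.
Proof.
move=> Vu /(_ i j) d ji; apply: cderiv_unique d _.
by apply: cderiv_ext (cderiv_cst 0 t) => // s; case: (Vu s) => ->.
Qed.

Lemma upper_real_mul n (A W : 'M[C]_n) :
  (forall i j : 'I_n, (j < i)%N -> A i j = 0) -> (forall i, Im (A i i) = 0) ->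
  upos W ->
  (forall i j : 'I_n, (j < i)%N -> (A *m W) i j = 0) /\
  (forall i, Im ((A *m W) i i) = 0).
Proof.
move=> A0 Ar [W0 Wp]; split=> [i j ji|i]; rewrite mxE.
  apply: big1 => k _; case: (ltnP k i) => [ki|ik]; first by rewrite A0// mul0r.
  by rewrite W0 ?mulr0// (leq_trans ji).
rewrite (bigD1 i)//= big1 => [|k ki].
  have [-> _] := gt0_real_complex (Wp i).
  by rewrite addr0 cImM Ar /= mulr0 mul0r addr0.
case: (ltngtP k i) => [?|?|/val_inj ki']; first by rewrite A0// mul0r.
  by rewrite W0 ?mulr0.
by rewrite ki' eqxx in ki.
Qed.

(* With g = Q V, differentiating g' = X g gives
   V X V^-1 = Q^* Q' + V' V^-1, the decomposition of the solution along k + u. *)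
Lemma toda_of_flow n (X : 'M[C]_n) (g : R -> 'M[C]_n) :
  \tr X = 0 -> (forall t, mderiv g t (X *m g t)) ->
  (forall t, g t \in unitmx) -> (forall t, X *m g t = g t *m X) ->
  exists V : R -> 'M[C]_n, [/\ forall t, upos (V t),
    forall t, unitary (g t *m invmx (V t)) &
    toda_solution (fun t => conjm (V t) X)].
Proof.
move=> trX dg gU gX.
have [t|//|V [W [dV dW VW]]] := @qr_smooth R n g.
  by exists (X *m g t).
have Vu t : upos (V t) by case: (VW t).
have WE t : invmx (V t) = W t.
  have [_ _ h _] := VW t.
  by rewrite -[LHS]mulmx1 -h mulKmx// upos_unitmx.
exists V; split=> // t; rewrite ?WE; first by case: (VW t).
have [V' hV] := dV t; have [W' hW] := dW t.
have [_ Wu VW1 QU] := VW t; have WV1 := mulmx1C VW1.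
(* The derivative of an inverse, from differentiating [V *m W = 1]. *)
have W'E : W' = - (W t *m V' *m W t).
  have h : V' *m W t + V t *m W' = 0.
    apply: mderiv_unique (mderivM hV hW) _.
    by apply: mderiv_ext (mderiv_cst 1%:M t) => // s; case: (VW s).
  move/eqP: h; rewrite addrC addr_eq0 => /eqP/(congr1 (mulmx (W t))).
  by rewrite mulmxA WV1 mul1mx mulmxN mulmxA.
set Q := g t *m W t in QU.
pose G := V t *m X *m W t; pose B := V' *m W t.
(* Since [X] commutes with [g], conjugating it by [V] or by the inverse of [Q] gives the same
   [G]. *)
have QG : Q *m G = X *m Q.
  by rewrite /Q /G -!mulmxA (mulmxA (W t)) WV1 mul1mx !mulmxA gX.
have dQ : mderiv (fun s => g s *m W s) t (X *m Q - Q *m B).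
  apply: mderiv_ext (mderivM (dg t) hW) => //.
  by rewrite W'E mulmxN !mulmxA.
have AE : adj Q *m (X *m Q - Q *m B) = G - B.
  by rewrite -QG -mulmxBr mulmxA QU mul1mx.
(* [G - B] is [adj Q] times the derivative of [Q]; differentiating [adj Q *m Q = 1] makes it
   skew-Hermitian. *)
have Ask : adj (G - B) = - (G - B).
  rewrite -AE adjM adjK; apply/eqP; rewrite -addr_eq0; apply/eqP.
  apply: mderiv_unique (mderivM (mderiv_adj dQ) dQ) _.
  by apply: mderiv_ext (mderiv_cst 1%:M t) => // s; case: (VW s).
have [B0 Br] := upper_real_mul (fun i j => @mderiv_upper n V t V' i j Vu hV)
  (fun i => mderiv_entry_real i Vu hV) Wu.
rewrite -/B in B0 Br.
have trG : \tr G = 0 by rewrite /G mxtrace_mulC mulmxA WV1 mul1mx.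
(* The trace of [B] is real since its diagonal is, and imaginary since [G] is traceless and [G - B]
   is skew-Hermitian. *)
have trB : \tr B = 0.
  apply: complex_eq; last by rewrite Im_sum big1.
  have /(congr1 (@complex.Re _)) := tr_adj (G - B).
  rewrite Ask cReJ opprB !linearB /= trG subr0 sub0r => /eqP.
  by rewrite -addr_eq0 -mulr2n mulrn_eq0 => /eqP.
exists (G - B); rewrite /conjm WE -/G; split.
  split; first by split=> //; rewrite linearB /= trG trB subrr.
  by rewrite opprB addrC subrK; split.
suff : mderiv (fun s => V s *m X *m W s) t (G *m (G - B) - (G - B) *m G).
  move=> h i j; have [h1 h2] := h i j.
  by split; [apply: is_derive_ext h1|apply: is_derive_ext h2] => // s; rewrite WE.
apply: mderiv_ext (mderivM (mderivM hV (mderiv_cst X t)) hW) => //.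
(* [G] commutes with itself, so its bracket with [G - B] is [B *m G - G *m B], which is also the
   derivative of the conjugate of [X] by [V]. *)
rewrite mulmx0 addr0 W'E mulmxN [RHS](_ : _ = B *m G - G *m B); last first.
  by rewrite mulmxBr mulmxBl opprB addrC addrA subrK.
by rewrite /G /B !mulmxA -(mulmxA V' (W t) (V t)) WV1 mulmx1.
Qed.

End Flow.

(** * Lower unipotent matrices and exponentials of diagonal matrices *)

Section Diagonal.
Variable R : realType.
Local Notation C := R[i].

Lemma inLM n (l m : 'M[C]_n) : inL l -> inL m -> inL (l *m m).
Proof.
move=> [l0 l1] [m0 m1]; split=> [i j ij|i]; rewrite mxE.
  apply: big1 => k _; case: (ltnP i k) => [ik|ki]; first by rewrite l0// mul0r.
  by rewrite m0 ?mulr0// (leq_ltn_trans ki).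
rewrite (bigD1 i)//= big1 ?addr0 ?l1 ?m1 ?mulr1// => k ki.
case: (ltngtP k i) => [?|?|/val_inj ki']; first by rewrite m0 ?mulr0.
  by rewrite l0// mul0r.
by rewrite ki' eqxx in ki.
Qed.

Lemma inL_diag_conj n (l : 'M[C]_n) (d e : 'rV[C]_n) :
  inL l -> diag_mx d *m diag_mx e = 1%:M -> inL (diag_mx d *m l *m diag_mx e).
Proof.
move=> [l0 l1] de; split=> [i j ij|i]; rewrite mul_mx_diag mul_diag_mx !mxE.
  by rewrite l0// mulr0 mul0r.
move/matrixP/(_ i i): de.
by rewrite mulmx_diag !mxE eqxx l1 mulr1.
Qed.

Lemma inL_block n (r : 'cV[C]_n) (l : 'M[C]_n) :
  inL l -> inL (block_mx (1%:M : 'M[C]_1) 0 r l).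
Proof.
move=> [l0 l1]; split=> [i j|i].
  case: (split_ordP i) => i' ->; case: (split_ordP j) => j' -> /=.
  - by rewrite !ord1.
  - by rewrite block_mxEur mxE.
  - by rewrite (ord1 j').
  - by rewrite block_mxEdr => ?; apply: l0.
case: (split_ordP i) => i' ->; last by rewrite block_mxEdr.
by rewrite block_mxEul !ord1 mxE eqxx.
Qed.

(** Induction on the size, splitting off the first row and column. The proof works with
    [l *m T = D *m l], [D] the diagonal part of [T]: this is linear in [l], and a new first column
    can be solved for because the diagonal entries are distinct. *)
Lemma lower_diagonalize n (T : 'M[C]_n) :
  (forall i j : 'I_n, (i < j)%N -> T i j = 0) ->
  (forall i j : 'I_n, i != j -> T i i != T j j) ->
  exists l m : 'M[C]_n, [/\ inL l, inL m, l *m m = 1%:M &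
    T = m *m diag_mx (\row_i T i i) *m l].
Proof.
suff main : (forall i j : 'I_n, (i < j)%N -> T i j = 0) ->
    (forall i j : 'I_n, i != j -> T i i != T j j) ->
    exists l m : 'M[C]_n, [/\ inL l, inL m, l *m m = 1%:M &
      l *m T = diag_mx (\row_i T i i) *m l].
  move=> T0 Td; have [l [m [lL mL lm lT]]] := main T0 Td.
  by exists l, m; split=> //; rewrite -mulmxA -lT mulmxA (mulmx1C lm) mul1mx.
elim: n T => [|n IH]; last rewrite -[n.+1]/(1 + n)%N; move=> T T0 Td.
  by exists 1%:M, 1%:M; split; try (by split=> -[]); rewrite [LHS]flatmx0 [RHS]flatmx0.
pose y := dlsubmx T; pose M := drsubmx T.
pose a := T (lshift n (0 : 'I_1)) (lshift n (0 : 'I_1)).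
have TE : T = block_mx a%:M 0 y M.
  rewrite -[LHS]submxK; congr block_mx; apply/matrixP => i j; rewrite !mxE !ord1.
    by rewrite eqxx.
  exact: T0.
have [i j ij|i j ij|l [m [lL mL lm lM]]] := IH M.
- by rewrite !mxE T0.
- by rewrite !mxE Td//; apply: contraNneq ij => /(@rshift_inj 1 n) ->.
have Ma i : M i i - a != 0.
  by rewrite subr_eq0 !mxE Td// eq_rlshift.
(* The lower left block of [l *m T = D *m l] reads [a *: r + l *m y = D' *m r] with [D'] the
   diagonal of [M], and this is its solution. *)
pose r : 'cV[C]_n := \col_i ((l *m y) i 0 / (M i i - a)).
exists (block_mx 1%:M 0 r l), (block_mx 1%:M 0 (- (m *m r)) m).
split; [exact: inL_block|exact: inL_block| |].
  rewrite mulmx_block !mulmx0 !mul0mx !addr0 !add0r mulmx1 mulmx1 mulmxN.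
  by rewrite mulmxA lm mul1mx subrr [RHS](scalar_mx_block 1 n).
have -> : diag_mx (\row_i T i i) = block_mx a%:M 0 0 (diag_mx (\row_i M i i)).
  rewrite -[\row_i T i i](@hsubmxK _ 1 1 n) diag_mx_row; congr block_mx.
    by apply/matrixP => i j; rewrite !ord1 !mxE eqxx.
  by congr diag_mx; apply/matrixP => i j; rewrite !mxE.
rewrite {1}TE !mulmx_block !mulmx0 !mul0mx !addr0 !add0r mul1mx mulmx1 lM.
congr block_mx; apply/matrixP => i j; rewrite mul_mx_scalar mul_diag_mx [j]ord1.
rewrite [LHS]mxE [(a *: r) _ _]mxE [r]lock mxE -lock [in RHS]mxE [r i 0]mxE.
set z := (l *m y) i 0.
by field.
Qed.

Lemma diag_mxE n (L : 'M[C]_n) : is_diag_mx L -> L = diag_mx (\row_i L i i).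
Proof.
move=> /is_diag_mxP L0; apply/matrixP => i j; rewrite !mxE.
by case: eqP => [->//|/eqP/eqP ij]; rewrite L0//; apply/eqP => /val_inj.
Qed.

(** For diagonal [L], [expRe] and [expIm] are the closed forms of the exponentials of t Re L and i t
    Im L; [mexp_Re] and [mexp_Im] identify them with the series. *)
Definition expRe n (L : 'M[C]_n) (t : R) : 'M[C]_n :=
  diag_mx (\row_i (expR (t * Re (L i i)))%:C).

Definition expIm n (L : 'M[C]_n) (t : R) : 'M[C]_n :=
  diag_mx (\row_i (cos (t * Im (L i i)) +i* sin (t * Im (L i i)))).

Lemma expReK n (L : 'M[C]_n) t : expRe L t *m expRe L (- t) = 1%:M.
Proof.
rewrite /expRe mulmx_diag; apply/matrixP => i j; rewrite !mxE; congr (_ *+ _).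
by rewrite -rmorphM -expRD mulNr subrr expR0.
Qed.

Lemma expImK n (L : 'M[C]_n) t : expIm L t *m expIm L (- t) = 1%:M.
Proof.
rewrite /expIm mulmx_diag; apply/matrixP => i j; rewrite !mxE; congr (_ *+ _).
rewrite mulNr cosN sinN; apply: complex_eq; rewrite ?cReM ?cImM /=.
  by rewrite mulrN opprK -!expr2 cos2Dsin2.
by rewrite mulrN mulrC addNr.
Qed.

Lemma expRe_upos n (L : 'M[C]_n) t : upos (expRe L t).
Proof.
split=> [i j ji|i]; rewrite !mxE; last by rewrite eqxx ltcR expR_gt0.
by rewrite (_ : i == j = false)//; apply/eqP => ij; rewrite ij ltnn in ji.
Qed.

Lemma adj_expIm n (L : 'M[C]_n) t : adj (expIm L t) = expIm L (- t).
Proof.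
apply/matrixP => i j; rewrite adjE !mxE; have [->|_] := eqVneq i j.
  by rewrite mulNr cosN sinN.
by rewrite mulr0n conjc0.
Qed.

Lemma expIm_unitary n (L : 'M[C]_n) t : unitary (expIm L t).
Proof. by apply: mulmx1C; rewrite adj_expIm expImK. Qed.

Lemma expRe0 n (L : 'M[C]_n) : expRe L 0 = 1%:M.
Proof. by apply/matrixP => i j; rewrite !mxE mul0r expR0. Qed.

Lemma expIm0 n (L : 'M[C]_n) : expIm L 0 = 1%:M.
Proof. by apply/matrixP => i j; rewrite !mxE mul0r cos0 sin0. Qed.

Lemma is_derive_scale (a t : R) : is_derive t (1 : R) (fun s => s * a) a.
Proof.
have := is_deriveZ a (is_derive_id t (1 : R)); apply: is_derive_ext => [s|].
  by rewrite /GRing.scale /= mulrC.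
by rewrite /GRing.scale /= mulr1.
Qed.

Lemma mderiv_expImRe n (L : 'M[C]_n) t : is_diag_mx L ->
  mderiv (fun s => expIm L s *m expRe L s) t (L *m (expIm L t *m expRe L t)).
Proof.
move=> Ld i j.
pose e s := (cos (s * Im (L i i)) +i* sin (s * Im (L i i))) * (expR (s * Re (L i i)))%:C.
have eE s : (expIm L s *m expRe L s) i j = e s * (i == j)%:R.
  by rewrite /expIm /expRe mulmx_diag !mxE mulr_natr.
have LE A : (L *m A) i j = L i i * A i j.
  by rewrite {1}(diag_mxE Ld) mul_diag_mx !mxE.
apply: (@cderiv_ext _ (fun s => e s * (i == j)%:R) _ _ (L i i * e t * (i == j)%:R)) => [s||].
- by rewrite eE.
- by rewrite LE eE mulrA.
have dc : cderiv (fun s => cos (s * Im (L i i)) +i* sin (s * Im (L i i))) t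
    ((- sin (t * Im (L i i)) * Im (L i i)) +i* (cos (t * Im (L i i)) * Im (L i i))).
  split=> /=.
    exact: (@is_derive1_comp _ (@cos R) _ _ _ _ _ (is_derive_scale _ _)).
  exact: (@is_derive1_comp _ (@sin R) _ _ _ _ _ (is_derive_scale _ _)).
have de : cderiv (fun s => (expR (s * Re (L i i)))%:C) t
    (expR (t * Re (L i i)) * Re (L i i))%:C.
  apply: cderiv_real.
  exact: (@is_derive1_comp _ (@expR R) _ _ _ _ _ (is_derive_scale _ _)).
apply: cderiv_ext (cderivM (cderivM dc de) (cderiv_cst (i == j)%:R t)) => //.
rewrite mulr0 addr0; congr (_ * _).
apply: complex_eq; rewrite !(cReM, cImM, cReD, cImD) /=; ring.
Qed.

End Diagonal.

(** * The exponential series of a diagonal matrix *)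

Section MatrixExp.
Variable R : realType.
Local Notation C := R[i].

Lemma diag_mxX n (d : 'rV[C]_n) k :
  diag_mx d ^+ k = diag_mx (\row_i (d 0 i ^+ k)).
Proof.
elim: k => [|k IH]; apply/matrixP => i j.
  by rewrite expr0 !mxE expr0.
by rewrite exprS IH [LHS](_ : _ = (diag_mx d *m diag_mx (\row_i (d 0 i ^+ k))) i j)//
  mulmx_diag !mxE exprS.
Qed.

Definition expsum (z : C) (N : nat) : C := \sum_(k < N) (k`!%:R)^-1 * z ^+ k.

Lemma mexp_diag n (d e : 'rV[C]_n) :
  (forall i, limn (fun N => Re (expsum (d 0 i) N)) = Re (e 0 i)) ->
  (forall i, limn (fun N => Im (expsum (d 0 i) N)) = Im (e 0 i)) ->
  mexp (diag_mx d) = diag_mx e.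
Proof.
move=> dRe dIm; apply/matrixP => i j; rewrite !mxE.
have sE N : (\sum_(k < N) (k`!%:R)^-1 *: diag_mx d ^+ k) i j =
    expsum (d 0 i) N *+ (i == j).
  rewrite summxE /expsum -sumrMnl; apply: eq_bigr => k _.
  by rewrite diag_mxX !mxE mulrnAr.
have lRe : limn (fun N => Re (expsum (d 0 i) N *+ (i == j))) = Re (e 0 i *+ (i == j)).
  by case: eqP => _; [rewrite -dRe|rewrite /= lim_cst].
have lIm : limn (fun N => Im (expsum (d 0 i) N *+ (i == j))) = Im (e 0 i *+ (i == j)).
  by case: eqP => _; [rewrite -dIm|rewrite /= lim_cst].
apply: complex_eq => /=.
- by rewrite -lRe; congr (limn _); apply/funext => N; rewrite sE.
- by rewrite -lIm; congr (limn _); apply/funext => N; rewrite sE.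
Qed.

Lemma natrC k : (k%:R : C) = (k%:R : R)%:C.
Proof. by rewrite rmorph_nat. Qed.

Lemma expsum_real (x : R) N : expsum x%:C N = (series (exp_coeff x) N)%:C.
Proof.
rewrite /expsum /series /= big_mkord rmorph_sum; apply: eq_bigr => k _.
by rewrite natrC -fmorphV -rmorphXn -rmorphM /exp_coeff /= mulrC.
Qed.

(** Even powers of i are real and give the cosine series, odd ones are imaginary and give the sine
    series; the partial sums agree term by term. *)
Lemma expsum_imag (x : R) N :
  expsum (0 +i* x) N = series (cos_coeff x) N +i* series (sin_coeff x) N.
Proof.
have -> : series (cos_coeff x) N +i* series (sin_coeff x) N =
    \sum_(k < N) (cos_coeff x k +i* sin_coeff x k).
  rewrite /series /= !big_mkord.
  by apply: complex_eq; rewrite ?Re_sum ?Im_sum.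
apply: eq_bigr => -[k _] _ /=.
have xE : 0 +i* x = 'i%C * x%:C :> C.
  by apply: complex_eq; rewrite ?cReM ?cImM /=; ring.
(* The exponent [k.-1./2] is the one of [sin_coeff]. It equals [k./2] for odd [k], and for even [k],
   including 0, the parity factor removes the term. *)
have ik : ('i%C : C) ^+ k = ((~~ odd k)%:R * (-1) ^+ k./2) +i*
    ((odd k)%:R * (-1) ^+ k.-1./2).
  rewrite -[in LHS](odd_double_half k) exprD -mul2n exprM sqr_i.
  have -> : ((-1) ^+ k./2 : C) = ((-1) ^+ k./2)%:C by rewrite rmorphXn rmorphN1.
  have [ko|ke] := boolP (odd k).
    have -> : k.-1./2 = k./2 by case: k ko => //= k; rewrite uphalf_half => /negbTE ->.
    by apply: complex_eq; rewrite ?cReM ?cImM /=; ring.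
  by apply: complex_eq; rewrite ?cReM ?cImM /=; ring.
rewrite xE exprMn ik natrC -fmorphV -rmorphXn /cos_coeff /sin_coeff /=.
by apply: complex_eq; rewrite -?exprnP ?(cReM, cImM) /=; ring.
Qed.

Lemma mexp_Re n (L : 'M[C]_n) t : is_diag_mx L ->
  mexp (t%:C *: mxRe L) = expRe L t.
Proof.
move=> Ld; have -> : t%:C *: mxRe L = diag_mx (\row_i (t * Re (L i i))%:C).
  apply/matrixP => i j; rewrite !mxE; have [->|ij] := eqVneq i j.
    by rewrite rmorphM.
  by move/is_diag_mxP: Ld => ->//; rewrite mulr0.
apply: mexp_diag => i; rewrite !mxE /=.
  by under eq_fun do rewrite expsum_real /=.
by under eq_fun do rewrite expsum_real /=; rewrite lim_cst.
Qed.

Lemma mexp_Im n (L : 'M[C]_n) t : is_diag_mx L ->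
  mexp ((- t%:C * complex.Complex 0 1) *: mxIm L) = expIm L (- t).
Proof.
move=> Ld; have -> : (- t%:C * complex.Complex 0 1) *: mxIm L =
    diag_mx (\row_i (0 +i* (- t * Im (L i i)))).
  apply/matrixP => i j; rewrite !mxE; have [->|ij] := eqVneq i j.
    by rewrite mulr1n; apply: complex_eq; rewrite !(cReM, cImM, cReN, cImN) /=; ring.
  by move/is_diag_mxP: Ld => ->//; rewrite mulr0.
apply: mexp_diag => i; rewrite !mxE /=.
  (* Unlocking exposes [cos], and in the next goal [sin], as the limits of these series. *)
  by under eq_fun do rewrite expsum_imag /=; rewrite unlock.
by under eq_fun do rewrite expsum_imag /=; rewrite unlock.
Qed.

End MatrixExp.

(** * The two factorizations of a Toda trajectory *)

Section Factorizations.
Variable R : realType.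
Local Notation C := R[i].

Lemma invmx_of_mulmx n (A B : 'M[C]_n) : A *m B = 1%:M -> invmx A = B.
Proof.
by move=> AB; rewrite -[LHS]mulmx1 -AB mulKmx//; case: (mulmx1_unit AB).
Qed.

Lemma conjm_mul n (A B X : 'M[C]_n) : A \in unitmx -> B \in unitmx ->
  conjm (A *m B) X = conjm A (conjm B X).
Proof.
move=> AU BU; rewrite /conjm.
have -> : invmx (A *m B) = invmx B *m invmx A.
  apply: invmx_of_mulmx.
  by rewrite -mulmxA (mulmxA B) mulmxV// mul1mx mulmxV.
by rewrite !mulmxA.
Qed.

Lemma conjm_comm n (A X : 'M[C]_n) : A \in unitmx -> A *m X = X *m A ->
  conjm A X = X.
Proof. by move=> AU AX; rewrite /conjm AX mulmxK. Qed.

Lemma conjm1 n (X : 'M[C]_n) : conjm 1%:M X = X.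
Proof. by rewrite conjm_comm ?unitmx1// mul1mx mulmx1. Qed.

Lemma expIm_unit n (L : 'M[C]_n) t : expIm L t \in unitmx.
Proof. by case: (mulmx1_unit (expImK L t)). Qed.

Lemma expRe_unit n (L : 'M[C]_n) t : expRe L t \in unitmx.
Proof. by case: (mulmx1_unit (expReK L t)). Qed.

Lemma diag_mx_comm n (L : 'M[C]_n) (d : 'rV[C]_n) : is_diag_mx L ->
  diag_mx d *m L = L *m diag_mx d.
Proof. by move=> /diag_mxE ->; exact: diag_mxC. Qed.

(** The curve [hi *m (expIm L t *m expRe L t) *m h] is exp(tX) without a general matrix exponential.
    Its QR factors give a solution by [toda_of_flow], and [toda_unique] carries the formulas over to
    every [F]. *)
Lemma toda_qr n (L X h hi : 'M[C]_n) :
  is_diag_mx L -> \tr L = 0 -> hi *m h = 1%:M -> X = hi *m L *m h ->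
  (exists F, toda_solution F /\ F 0 = X) /\
  forall F, toda_solution F -> F 0 = X -> forall t, exists Q V,
    [/\ unitary Q, upos V, hi *m (expIm L t *m expRe L t) *m h = Q *m V,
        F t = conjm V X & F t = conjm (invmx Q) X].
Proof.
move=> Ld trL hih XE; have hhi := mulmx1C hih.
have [E EE] : exists E, forall t, E t = expIm L t *m expRe L t by eexists.
pose g t := hi *m E t *m h.
have EU t : E t \in unitmx by rewrite EE unitmx_mul expIm_unit expRe_unit.
have EL t : E t *m L = L *m E t.
  by rewrite EE /expIm /expRe mulmx_diag diag_mx_comm.
have [hiU hU] := mulmx1_unit hih.
have Xg t : X *m g t = hi *m (L *m E t) *m h.
  by rewrite XE /g !mulmxA -(mulmxA _ h hi) hhi mulmx1.
have gX t : X *m g t = g t *m X.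
  by rewrite Xg XE /g !mulmxA -(mulmxA _ h hi) hhi mulmx1 -(mulmxA hi (E t)) EL !mulmxA.
have gU t : g t \in unitmx by rewrite !unitmx_mul hiU hU EU.
have [|t|//|//|V [Vu QU sV]] := @toda_of_flow _ n X g.
- by rewrite XE mxtrace_mulC mulmxA hhi mul1mx.
- rewrite Xg.
  have := mderivM (mderivM (mderiv_cst hi t) (mderiv_expImRe t Ld)) (mderiv_cst h t).
  by apply: mderiv_ext => [s|]; rewrite ?mulmx0 ?addr0 ?mul0mx ?add0r -EE.
(* At time 0 the curve is the identity, whose QR factors are trivial by uniqueness; hence the
   solution starts at [X]. *)
have V0 : V 0 = 1%:M.
  have g0 : g 0 = 1%:M by rewrite /g EE expIm0 expRe0 mulmx1 mulmx1.
  have := QU 0; rewrite g0 mul1mx => VU.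
  have [] // := @qr_unique _ n (invmx (V 0)) 1%:M (V 0) 1%:M VU.
  - by rewrite /unitary adj_mx1 mulmx1.
  - by rewrite -(expRe0 L); apply: expRe_upos.
  - by rewrite mulVmx ?upos_unitmx// mulmx1.
have V0X : conjm (V 0) X = X by rewrite V0 conjm1.
split; first by exists (fun t => conjm (V t) X).
move=> F sF F0 t; have Vun := upos_unitmx (Vu t).
have FE : F t = conjm (V t) X by rewrite (toda_unique sF sV)// F0 V0X.
exists (g t *m invmx (V t)), (V t); split=> //; first by rewrite -EE mulmxKV.
have Qun := unitary_unit (QU t).
(* Conjugation by [g t] fixes [X], so conjugating by the inverse of [Q] is the same as conjugating
   by the inverse of [Q] times [g t], which is [V t]. *)
rewrite FE -[in RHS](conjm_comm (gU t) (esym (gX t))) -conjm_mul ?unitmx_inv//.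
by congr conjm; rewrite -{2}(mulmxKV Vun (g t)) mulKmx.
Qed.

Lemma in_lalg_diag n (L Y : 'M[C]_n) :
  is_diag_mx L -> (forall i j : 'I_n, i != j -> L i i != L j j) -> in_lalg Y ->
  exists l m : 'M[C]_n, [/\ inL l, inL m, m *m l = 1%:M & L + Y = m *m L *m l].
Proof.
move=> Ld Ls Yl.
have dE i : (L + Y) i i = L i i by rewrite mxE Yl ?addr0.
have [i j ij|i j ij|l [m [lL mL lm TE]]] := @lower_diagonalize _ n (L + Y).
- rewrite mxE Yl ?addr0 1?ltnW//; move/is_diag_mxP: Ld; apply.
  by apply/eqP => ij'; rewrite ij' ltnn in ij.
- by rewrite !dE Ls.
exists l, m; split=> //; first exact: mulmx1C.
rewrite {1}TE; congr (_ *m _ *m _); rewrite [RHS](diag_mxE Ld); congr diag_mx.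
by apply/matrixP => i j; rewrite mxE [RHS]mxE dE.
Qed.

(** Moves [DI] to the far left and [DR] to the far right. For lower unipotent [a], [b] and diagonal
    exponentials, the matrix left in the middle is again lower unipotent. *)
Lemma diag_shuffle n (DI DI' DR DR' a b : 'M[C]_n) :
  DI *m DI' = 1%:M -> DR' *m DR = 1%:M ->
  a *m (DI *m DR) *m b = DI *m ((DI' *m a *m DI) *m (DR *m b *m DR')) *m DR.
Proof.
move=> IK RK.
by rewrite -!mulmxA RK mulmx1 (mulmxA DI DI') IK mul1mx !mulmxA.
Qed.

Lemma inL_expIm n (L l : 'M[C]_n) t : inL l -> inL (expIm L (- t) *m l *m expIm L t).
Proof. by move=> lL; apply: inL_diag_conj => //; apply: mulmx1C; apply: expImK. Qed.

Lemma inL_expRe n (L l : 'M[C]_n) t : inL l -> inL (expRe L t *m l *m expRe L (- t)).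
Proof. by move=> lL; apply: inL_diag_conj => //; apply: expReK. Qed.

(** Write [l0 = k *m u0]. Multiplying exp(tX) by [u0] on the right turns the trailing [k] into [l0],
    so exp(tX) [u0] is the inverse of [k] times a product to which [diag_shuffle] applies.
    Uniqueness of QR then reads off [Q]. *)
Lemma toda_Im_factor n (L X Y k : 'M[C]_n) F t :
  is_diag_mx L -> (forall i j : 'I_n, i != j -> L i i != L j j) -> \tr L = 0 ->
  in_lalg Y -> in_calC k -> X = conjm (invmx k) (L + Y) ->
  toda_solution F -> F 0 = X ->
  (exists lIm kt, inL lIm /\ (exists v, is_KU lIm kt v) /\
     F t = conjm (invmx kt) (conjm (expIm L (- t)) (L + Y))) /\
  in_calU L (F t).
Proof.
move=> Ld Ls trL Yl [l0 [u0 [l0L [kK [u0U l0E]]]]] XE sF F0.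
have [l [m [lL mL ml TE]]] := in_lalg_diag Ld Ls Yl.
have kU := inK_unitary kK; have kun := unitary_unit kU.
have hih : (invmx k *m m) *m (l *m k) = 1%:M.
  by rewrite -mulmxA (mulmxA m) ml mul1mx mulVmx.
have XE' : X = (invmx k *m m) *m L *m (l *m k).
  by rewrite XE /conjm invmxK TE !mulmxA.
have [_ /(_ _ sF F0 t)[Q [V [QU Vu QV _ FQ]]]] := toda_qr Ld trL hih XE'.
have DIL : expIm L t *m L = L *m expIm L t by apply: diag_mx_comm.
have lImL := inLM (inL_expIm L t mL) (inL_expRe L t (inLM lL l0L)).
have l'L := inL_expIm L t lL.
(* From here on only the algebraic relations of the four exponentials are used. *)
move: (expIm L t) (expIm L (- t)) (expRe L t) (expRe L (- t)) QV DIL lImL l'L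
  (expImK L t) (expIm_unitary L t) (mulmx1C (expReK L t)) (expRe_upos L t).
move=> DI DI' DR DR' QV DIL lImL l'L IK DIU RK DRu.
have [kt [vt KU]] := inL_KU lImL.
have [ktK [vtU lImE]] := KU; have ktU := inK_unitary ktK.
have ktun := unitary_unit ktU.
have QE : Q = invmx k *m DI *m kt.
  have E : Q *m (V *m u0) = (invmx k *m DI *m kt) *m (vt *m DR).
    rewrite mulmxA -QV -[in RHS](mulmxA _ kt) (mulmxA kt) -lImE.
    rewrite -(mulmxA (invmx k) DI) (mulmxA DI) -(diag_shuffle _ _ IK RK) l0E.
    by rewrite !mulmxA.
  have WU := unitaryM (unitaryM (unitary_invmx kU) DIU) ktU.
  by case: (qr_unique QU WU (uposM Vu (inU_upos u0U)) (uposM (inU_upos vtU) DRu) E).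
have [DIun DI'un] := mulmx1_unit IK.
have FE : F t = conjm (invmx kt) (conjm DI' (L + Y)).
  have QK : Q *m (invmx kt *m DI' *m k) = 1%:M.
    rewrite QE -!mulmxA (mulmxA kt) mulmxV// mul1mx (mulmxA DI) IK mul1mx.
    exact: mulVmx.
  rewrite FQ (invmx_of_mulmx QK) XE.
  have ktiU : invmx kt \in unitmx by rewrite unitmx_inv.
  have kiU : invmx k \in unitmx by rewrite unitmx_inv.
  have DkU : invmx kt *m DI' \in unitmx by rewrite unitmx_mul ktiU.
  rewrite (conjm_mul _ DkU kun) (conjm_mul _ ktiU DI'un) -(conjm_mul _ kun kiU).
  by rewrite (mulmxV kun) conjm1.
split.
  exists (DI' *m m *m DI *m (DR *m (l *m l0) *m DR')), kt; split=> //.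
  by split=> //; exists vt.
(* [DI] commutes with [L], so the conjugate of [L + Y = m *m L *m l] by [DI'] is [L] conjugated by
   the lower unipotent [DI' *m m *m DI], whose inverse is this witness. *)
exists kt, (DI' *m l *m DI); split.
  by exists (DI' *m m *m DI *m (DR *m (l *m l0) *m DR')), vt.
have mE : m *m L *m l = conjm m L by rewrite /conjm (invmx_of_mulmx ml).
split=> //; rewrite FE TE mE.
have lmK : (DI' *m l *m DI *m kt) *m (invmx kt *m (DI' *m (m *m DI))) = 1%:M.
  rewrite -!mulmxA (mulmxA kt) mulmxV// mul1mx.
  rewrite (mulmxA DI) IK mul1mx (mulmxA l) (mulmx1C ml) mul1mx.
  exact: mulmx1C IK.
have mU := inL_unit mL.
have ktiU : invmx kt \in unitmx by rewrite unitmx_inv.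
have mDU : m *m DI \in unitmx by rewrite unitmx_mul mU.
have DmDU : DI' *m (m *m DI) \in unitmx by rewrite unitmx_mul DI'un.
rewrite (invmx_of_mulmx lmK) (conjm_mul _ ktiU DmDU) (conjm_mul _ DI'un mDU).
by rewrite (conjm_mul _ mU DIun) (conjm_comm DIun DIL).
Qed.

(** The counterpart on the other side: with [l0 = k0 *m u], multiplying exp(tX) by [u] on the right
    cancels the trailing inverse of [u], and the leading [u] is the inverse of [k0] times [l0]. The
    upper factor is now compared, giving [V *m u = vt *m DR]. *)
Lemma toda_Re_factor n (L X Z u : 'M[C]_n) F t :
  is_diag_mx L -> (forall i j : 'I_n, i != j -> L i i != L j j) -> \tr L = 0 ->
  in_lalg Z -> in_calD u -> X = conjm u (L + Z) ->
  toda_solution F -> F 0 = X ->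
  exists lRe vt, inL lRe /\ (exists kk, is_KU lRe kk vt) /\
     F t = conjm vt (conjm (expRe L t) (L + Z)).
Proof.
move=> Ld Ls trL Zl [l0 [k0 [l0L [k0K [uU l0E]]]]] XE sF F0.
have [l [m [lL mL ml TE]]] := in_lalg_diag Ld Ls Zl.
have k0U := inK_unitary k0K; have k0un := unitary_unit k0U.
have uu := inU_upos uU; have uun := upos_unitmx uu.
have uE : invmx k0 *m l0 = u by rewrite l0E mulKmx.
have hih : (u *m m) *m (l *m invmx u) = 1%:M.
  by rewrite -mulmxA (mulmxA m) ml mul1mx mulmxV.
have XE' : X = (u *m m) *m L *m (l *m invmx u) by rewrite XE /conjm TE !mulmxA.
have [_ /(_ _ sF F0 t)[Q [V [QU Vu QV FE _]]]] := toda_qr Ld trL hih XE'.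
have lReL := inLM (inL_expIm L t (inLM l0L mL)) (inL_expRe L t lL).
move: (expIm L t) (expIm L (- t)) (expRe L t) (expRe L (- t)) QV lReL
  (expImK L t) (expIm_unitary L t) (mulmx1C (expReK L t)) (expRe_upos L t).
move=> DI DI' DR DR' QV lReL IK DIU RK DRu.
have [kk [vt KU]] := inL_KU lReL.
have [kkK [vtU lReE]] := KU; have kkU := inK_unitary kkK.
have vtun := upos_unitmx (inU_upos vtU).
have VE : V *m u = vt *m DR.
  have E : Q *m (V *m u) = (invmx k0 *m DI *m kk) *m (vt *m DR).
    rewrite mulmxA -QV -[in RHS](mulmxA _ kk) (mulmxA kk) -lReE.
    rewrite -(mulmxA (invmx k0) DI) (mulmxA DI) -(diag_shuffle _ _ IK RK).
    by rewrite !mulmxA uE mulmxKV.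
  have WU := unitaryM (unitaryM (unitary_invmx k0U) DIU) kkU.
  by case: (qr_unique QU WU (uposM Vu uu) (uposM (inU_upos vtU) DRu) E).
exists (DI' *m (l0 *m m) *m DI *m (DR *m l *m DR')), vt.
split=> //; split; first by exists kk.
rewrite FE XE -(conjm_mul _ (upos_unitmx Vu) uun) VE.
by rewrite (conjm_mul _ vtun (upos_unitmx DRu)).
Qed.

End Factorizations.

Theorem theorem2p7 (R : realType) (n : nat) (Lam X Y Z k u : 'M[R[i]]_n) :
  is_diag_mx Lam ->
  (forall i j : 'I_n, i != j -> Lam i i != Lam j j) ->
  \tr Lam = 0 ->
  in_calU Lam X ->
  in_lalg Y -> in_lalg Z -> in_calC k -> in_calD u ->
  X = conjm (invmx k) (Lam + Y) ->
  X = conjm u (Lam + Z) ->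
  (exists F : R -> 'M[R[i]]_n, toda_solution F /\ F 0 = X) /\
  (forall F : R -> 'M[R[i]]_n, toda_solution F -> F 0 = X ->
   forall t : R,
     (exists lIm kt : 'M[R[i]]_n,
        inL lIm /\ (exists v, is_KU lIm kt v) /\
        F t = conjm (invmx kt)
                (conjm (mexp ((- t%:C * complex.Complex 0 1) *: mxIm Lam)) (Lam + Y))) /\
     (exists lRe vt : 'M[R[i]]_n,
        inL lRe /\ (exists kk, is_KU lRe kk vt) /\
        F t = conjm vt (conjm (mexp (t%:C *: mxRe Lam)) (Lam + Z))) /\
     in_calU Lam (F t)).
Proof.
move=> Ld Ls trL _ Yl Zl kC uD XY XZ; split.
  (* Existence: the form of [X] in [Z] and [u] exhibits [X] as a conjugate of [Lam] by [u *m m],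
     which is what [toda_qr] takes as input. *)
  have [l [m [_ _ ml TE]]] := in_lalg_diag Ld Ls Zl.
  have uun : u \in unitmx.
    by case: uD => ? [? [_ [_ [/inU_upos/upos_unitmx]]]].
  have [|| //] := @toda_qr R n Lam X (l *m invmx u) (u *m m) Ld trL.
    by rewrite -mulmxA (mulmxA m) ml mul1mx mulmxV.
  by rewrite XZ /conjm TE !mulmxA.
move=> F sF F0 t; rewrite mexp_Re// mexp_Im//.
have [FIm FU] := toda_Im_factor t Ld Ls trL Yl kC XY sF F0.
by split=> //; split=> //; apply: toda_Re_factor XZ sF F0.
Qed.
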